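(* For every integer $q\ge2$, the two-stage local criterion is rate-complete: $$\rho_{\mathrm{crit}}^{(q)}=C_0^{(q)},$$ where $\rho_{\mathrm{crit}}^{(q)}$ is the supremum of the block rates $R(P)$ over all finite nonempty block sets $P\subseteq\Sigma_q^*$ certified by the two-stage local criterion, and $C_0^{(q)}$ is the zero-error capacity of the radius-one limited permutation channel over $\Sigma_q$. In particular, in the binary case, $\rho_{\mathrm{crit}}^{(2)}=C_0$, where $C_0=C_0^{(2)}$.
   Context: $\Sigma_q=\{0,1,\dots,q-1\}$. For $c=c_1\cdots c_n\in\Sigma_q^n$, the radius-one ball $B(c)$ is the set of all words $z=z_1\cdots z_n$ with $z_i=c_{\pi(i)}$ for some permutation $\pi$ of $\{1,\dots,n\}$ satisfying $|\pi(i)-i|\le 1$ for all $i$; equivalently, all words obtained from $c$ by swapping the symbols in any set of pairwise disjoint pairs of adjacent positions. A nonempty code $C\subseteq\Sigma_q^n$ is correcting if $B(c)\cap B(c')=\emptyset$ for all distinct $c,c'\in C$. $A_q(n;1)$ is the maximum size of a correcting code in $\Sigma_q^n$, and $C_0^{(q)}=\limsup_{n\to\infty}\frac1n\log_q A_q(n;1)$. A block set is a finite nonempty set $P\subseteq\Sigma_q^*$ of nonempty words. With $p_\ell=|\{p\in P:|p|=\ell\}|$, let $\lambda$ be the unique positive solution of $\sum_{\ell\ge1}p_\ell\lambda^{-\ell}=1$; the block rate is $R(P)=\log_q\lambda$. $P^*=\{p_1\cdots p_m:m\ge0,\ p_i\in P\}$. For $d\ge0$, $\mathrm{Pref}_d(P^*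 )$ is the set of length-$d$ prefixes of words in $P^*$ (of length at least $d$). $\mathrm{pref}_k(w)$ is the length-$k$ prefix of $w$. For $u,v\in\Sigma_q^\ell$, $D_{\min}(u,v)=\min\{d_{\mathrm H}(u',v') : u'\in B(u),\ v'\in B(v)\}$ with $d_{\mathrm H}$ the Hamming distance. When $D_{\min}(u,v)=1$, a closest witness is a pair $(u',v')\in B(u)\times B(v)$ with $d_{\mathrm H}(u',v')=1$. Same-length boundary test: for $u,v\in\Sigma_q^\ell$, $(u,v)$ passes if (E1) $D_{\min}(u,v)\ne0$; and (E2) if $D_{\min}(u,v)=1$, then no closest witness differs in the last coordinate $\ell$. Two-stage unequal-length test: for $x,y\in P$ with $\ell_x=|x|<\ell_y=|y|$, put $d=\ell_y-\ell_x$, $y_0=\mathrm{pref}_{\ell_x}(y)$. The ordered pair $(x,y)$ passes if (U1) $D_{\min}(x,y_0)\ne0$; and (U2) if $D_{\min}(x,y_0)=1$, then for every $\rho\in\mathrm{Pref}_d(P^* )$ the pair $(x\rho,y)$ passes the same-length boundary test. $P$ is certified by the two-stage local criterion if (C1) every two distinct blocks of $P$ of the same length pass the same-length boundary test, and (C2) every ordered pair $(x,y)\in P^2$ with $|x|<|y|$ passes the two-stage unequal-length test. *)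

(* Defs.v *)
From HB Require Import structures.
From mathcomp Require Import all_boot all_order all_fingroup all_algebra finmap.
From mathcomp Require Import all_classical all_reals all_analysis.

Set Implicit Arguments.
Unset Strict Implicit.
Unset Printing Implicit Defensive.

Import Order.TTheory GRing.Theory Num.Theory.

Local Open Scope nat_scope.

Section Channel.
Variable T : finType.
Implicit Types (c u v w x y z : seq T) (P : {fset seq T}).

Definition limited_perm n (s : {perm 'I_n}) : bool :=
  [forall i : 'I_n, (s i <= i.+1) && (i <= (s i).+1)].

Definition permute_word c (s : {perm 'I_(size c)}) : seq T :=
  [seq tnth (in_tuple c) (s i) | i <- enum 'I_(size c)].

Definition rball c : {fset seq T} :=
  [fset permute_word s |
     s in [pred s : {perm 'I_(size c)} | limited_perm s]]%fset.

Definition correcting n (C : {set n.-tuple T}) : bool :=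
  (C != finset.set0) &&
  [forall c in C, forall c' in C,
     (c != c') ==> [disjoint rball c & rball c']%fset].

Definition max_code_size n : nat :=
  \max_(C : {set n.-tuple T} | correcting C) #|C|.

(* Meaningful for words of equal length only, since [zip] truncates. *)
Definition hamming u v : nat := count (fun ab => ab.1 != ab.2) (zip u v).

(* Used for words of equal length only.  The neutral element [size u] bounds
   every distance occurring in the minimum, and balls are nonempty, so it never
   changes the value. *)
Definition Dmin u v : nat :=
  \big[minn/size u]_(u' <- rball u) \big[minn/size u]_(v' <- rball v)
    hamming u' v'.

Definition closest_witness u v u' v' : Prop :=
  [/\ u' \in rball u, v' \in rball v & hamming u' v' = 1].

(* The last coordinate of a word of length [size u] has 0-based index
   [(size u).-1]. *)
Definition same_length_test u v : Prop :=
  Dmin u v <> 0 /\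
  (Dmin u v = 1 ->
   ~ exists u' v', closest_witness u v u' v' /\
                   onth u' (size u).-1 <> onth v' (size u).-1).

Definition block_set P : Prop := P != fset0 /\ [::] \notin P.

Definition star P w : Prop :=
  exists ps : seq (seq T), {subset ps <= P} /\ w = flatten ps.

Definition pref_star d P (r : seq T) : Prop :=
  exists w, [/\ star P w, d <= size w & r = take d w].

Definition two_stage_test P x y : Prop :=
  let d := size y - size x in
  let y0 := take (size x) y in
  Dmin x y0 <> 0 /\
  (Dmin x y0 = 1 ->
   forall r, pref_star d P r -> same_length_test (x ++ r) y).

Definition certified P : Prop :=
  (forall x y, x \in P -> y \in P -> x <> y -> size x = size y ->
     same_length_test x y) /\
  (forall x y, x \in P -> y \in P -> size x < size y ->
     two_stage_test P x y).

Definition block_count P l : nat := #|` [fset p in P | size p == l]%fset |.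

End Channel.

Local Open Scope ring_scope.

Section Rates.
Variables (R : realType) (q : nat).

Definition logq (x : R) : R := ln x / ln q%:R.

(* Lengths above the maximal block length contribute zero terms. *)
Definition growth_root (P : {fset seq 'I_q}) (lam : R) : Prop :=
  0 < lam /\
  \sum_(1 <= l < (\max_(p <- P) size p).+1)
     (block_count P l)%:R * lam ^- l = 1.

(* For a block set the root exists and is unique; the default 1 is then
   irrelevant. *)
Definition block_rate (P : {fset seq 'I_q}) : R :=
  logq (xget 1 [set lam | growth_root P lam]%classic).

Definition rho_crit : \bar R :=
  ereal_sup [set (block_rate P)%:E |
             P in [set P : {fset seq 'I_q} | block_set P /\ certified P]]%classic.

(* The value at n = 0 is 0 and does not affect the limsup. *)
Definition capacity : \bar R :=
  limn_esup (fun n : nat =>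
    (logq (max_code_size 'I_q n)%:R / n%:R)%:E).

End Rates.

(* Main.v *)
Require Import Defs.
From mathcomp Require Import all_boot all_order all_fingroup all_algebra finmap.
From mathcomp Require Import all_classical all_reals all_analysis.
From mathcomp Require Import zify lra.

(* Cutting a word of a ball at a block boundary spoils at most the last letter
   before the cut, so a word common to the balls of two distinct concatenations
   of blocks yields, at the first place where the blocks differ, a pair at
   distance at most 1 whose only possible difference is in the last coordinate:
   exactly what the criterion forbids. Hence distinct concatenations have
   disjoint balls, and counting m-fold concatenations by total length (each
   weighted by lambda^-length, total weight 1) shows that the capacity is at
   least every certified rate. Conversely, if C is a correcting code of length
   n, then the blocks c00, c in C, are certified of rate log_q |C| / (n + 2). *)

Set Implicit Arguments.
Unset Strict Implicit.
Unset Printing Implicit Defensive.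

Import Order.TTheory GRing.Theory Num.Theory.

Local Open Scope nat_scope.

(** * Balls as sets of disjoint adjacent swaps, and pairs of words whose balls meet *)

Section Swaps.
Variable T : finType.
Implicit Types (a b : T) (c u v w x y z : seq T) (P : {fset seq T}).

(** A left-to-right parse into fixed letters and adjacent swaps turns statements about balls into
    inductions; [rballP] links it to the permutation definition. *)
Inductive swapped : seq T -> seq T -> Prop :=
| swapped_nil : swapped [::] [::]
| swapped_fix a c z : swapped c z -> swapped (a :: c) (a :: z)
| swapped_swap a b c z : swapped c z -> swapped (a :: b :: c) (b :: a :: z).

Lemma swapped_refl c : swapped c c.
Proof. by elim: c => [|a c IHc]; constructor. Qed.

Lemma swapped_cat c1 z1 c2 z2 :
  swapped c1 z1 -> swapped c2 z2 -> swapped (c1 ++ c2) (z1 ++ z2).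
Proof. by move=> s1 s2; elim: s1 => //= *; constructor. Qed.

(** Transfers facts about the first letter to the last one. *)
Lemma swapped_rev c z : swapped c z -> swapped (rev c) (rev z).
Proof.
elim=> [|a c' z' _ IH|a b c' z' _ IH]; first by constructor.
  by rewrite !rev_cons -!cats1; apply: swapped_cat IH (swapped_refl _).
rewrite !rev_cons -!cats1 -!catA; apply: swapped_cat IH _ => /=.
by do 2!constructor.
Qed.

Lemma size_swapped c z : swapped c z -> size z = size c.
Proof. by elim=> //= *; congruence. Qed.

Lemma swapped_consE a c z : swapped (a :: c) z ->
  (exists2 z', z = a :: z' & swapped c z') \/
  exists b c' z', [/\ c = b :: c', z = b :: a :: z' & swapped c' z'].
Proof.
move=> s; inversion s as [|a0 c0 z0 s0|a0 b c0 z0 s0]; first by left; exists z0.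
by right; exists b, c0, z0.
Qed.

Definition meet c c' := exists2 z, swapped c z & swapped c' z.

(** If one parse fixes [a] and the other swaps it, the swap exchanges two equal letters and can be
    replaced by fixing them. If both swap, [c] and [c'] start with the same letter [b], and deleting
    [a] from the common word leaves a common word. *)
Lemma meet_cons a c c' : meet (a :: c) (a :: c') -> meet c c'.
Proof.
case=> z /swapped_consE[[z1 -> s1]|[b [c1 [z1 [-> -> s1]]]]].
  case/swapped_consE=> [[_ [<-] s1']|[b [c1 [z1' [-> [<- z1E] s1']]]]].
    by exists z1.
  by exists (a :: z1'); [rewrite -z1E | constructor].
case/swapped_consE=> [[_ [-> <-] s1']|[_ [c1' [_ [-> [<- <-] s1']]]]].
  by exists (a :: z1) => //; constructor.
by exists (b :: z1); constructor.
Qed.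

Lemma meet_rcons a c c' : meet (rcons c a) (rcons c' a) -> meet c c'.
Proof.
case=> z /swapped_rev s /swapped_rev s'; move: s s'; rewrite !rev_rcons => s s'.
have [z' /swapped_rev + /swapped_rev] := meet_cons (ex_intro2 _ _ _ s s').
by rewrite !revK; exists (rev z').
Qed.

Lemma meet_catl p c c' : meet (p ++ c) (p ++ c') -> meet c c'.
Proof. by elim: p => //= a p IHp /meet_cons. Qed.

(* A swap across the cut only spoils the last letter of the prefix. *)
Lemma swapped_prefix x a c z : swapped (rcons x a ++ c) z ->
  exists b, swapped (rcons x a) (rcons (take (size x) z) b).
Proof.
have [n] := ubnP (size x); elim: n x a c z => // n IH x a c z.
case: x => [|x1 x] /= ltn s; first by exists a; rewrite take0; apply: swapped_refl.
case/swapped_consE: s => [[z1 -> s1]|[b [c1 [z1 [xE -> s1]]]]].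
  by have [b' ?] := IH _ _ _ _ ltn s1; exists b'; constructor.
case: x ltn xE => [|x2 x] /= ltn [-> c1E]; first by exists x1; do 2!constructor.
rewrite -c1E in s1.
by have [b' ?] := IH _ _ _ _ (ltnW ltn) s1; exists b'; constructor.
Qed.

(** The index map is total on [nat], so that prepending letters is a plain shift without casts
    between ordinals. Involutivity later supplies the injectivity of a permutation. *)
Lemma swapped_index a0 c z : swapped c z -> exists f : nat -> nat,
  [/\ involutive f, forall i, f i <= i.+1 /\ i <= (f i).+1,
      forall i, i < size c -> f i < size c &
      z = mkseq (fun i => nth a0 c (f i)) (size c)].
Proof.
elim=> [|a c' z' s [f [f_inv f_lim f_lt zE]]|a b c' z' s [f [f_inv f_lim f_lt zE]]].
- by exists id; split=> //; split; apply: leqnSn.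
- exists (fun i => if i is j.+1 then (f j).+1 else 0); split.
  + by case=> //= i; rewrite f_inv.
  + by case=> //= i; exact: f_lim.
  + by case=> //= i; exact: f_lt.
  + rewrite /mkseq /= zE; congr cons; rewrite (iotaDl 1 0) -map_comp.
    exact: eq_map.
- exists (fun i => match i with 0 => 1 | 1 => 0 | j.+2 => (f j).+2 end); split.
  + by case=> [|[|i]] //=; rewrite f_inv.
  + by case=> [|[|i]] //=; exact: f_lim.
  + by case=> [|[|i]] //=; exact: f_lt.
  + rewrite /mkseq /= zE; do 2!congr cons; rewrite (iotaDl 2 0) -map_comp.
    exact: eq_map.
Qed.

(** The displacement bound leaves [f 0] equal to 0 or 1. If it is 1, then 0 can only be the image of
    1, so [f] exchanges 0 and 1. Either way the remaining indices are permuted among themselves, and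
    [f] is shifted down; the inverse [g] is carried along to justify this. *)
Lemma index_swapped a0 c (f g : nat -> nat) : cancel f g -> cancel g f ->
  (forall i, f i <= i.+1 /\ i <= (f i).+1) ->
  (forall i, i < size c -> f i < size c) ->
  swapped c (mkseq (fun i => nth a0 c (f i)) (size c)).
Proof.
have [n] := ubnP (size c); elim: n c f g => // n IH c f g.
case: c => [|a c] /= ltn fK gK f_lim f_lt; first by constructor.
have g_lim i : g i <= i.+1 /\ i <= (g i).+1.
  by have := f_lim (g i); rewrite gK; case.
have [f0|f0] : f 0 = 0 \/ f 0 = 1 by have := f_lim 0; lia.
- have g0 : g 0 = 0 by rewrite -{1}f0 fK.
  have fS i : (f i.+1).-1.+1 = f i.+1.
    by case fE: (f i.+1) => //; have := fK i.+1; rewrite fE g0.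
  have gS i : (g i.+1).-1.+1 = g i.+1.
    by case gE: (g i.+1) => //; have := gK i.+1; rewrite gE f0.
  rewrite /mkseq /= f0 /= (iotaDl 1 0) -map_comp; constructor.
  have := IH c (fun i => (f i.+1).-1) (fun i => (g i.+1).-1).
  have -> : [seq ((fun i => nth a0 (a :: c) (f i)) \o addn 1) i |
      i <- iota 0 (size c)] =
    mkseq (fun i => nth a0 c (f i.+1).-1) (size c).
    by apply: eq_map => i /=; rewrite add1n -fS.
  apply=> //.
  + by move=> i; rewrite fS fK.
  + by move=> i; rewrite gS gK.
  + by move=> i; have := f_lim i.+1; have := fS i; lia.
  + by move=> i lti; have := f_lt i.+1; have := fS i; lia.
- have g1 : g 1 = 0 by rewrite -{1}f0 fK.
  have g0 : g 0 = 1.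
    have [? _] := g_lim 0; case E: (g 0) => [|[|k]]; last by lia.
    + by have := gK 0; rewrite E f0.
    + by [].
  have f1 : f 1 = 0 by rewrite -g0 gK.
  case: c ltn f_lt => [|b c] /= ltn f_lt.
    by have := f_lt 0 isT; rewrite f0.
  have fS i : (f i.+2).-2.+2 = f i.+2.
    by case fE: (f i.+2) => [|[|]] //; have := fK i.+2; rewrite fE ?g0 ?g1.
  have gS i : (g i.+2).-2.+2 = g i.+2.
    by case gE: (g i.+2) => [|[|]] //; have := gK i.+2; rewrite gE ?f0 ?f1.
  rewrite /mkseq /= f0 f1 /= (iotaDl 2 0) -map_comp; constructor.
  have := IH c (fun i => (f i.+2).-2) (fun i => (g i.+2).-2).
  have -> : [seq ((fun i => nth a0 [:: a, b & c] (f i)) \o addn 2) i |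
      i <- iota 0 (size c)] =
    mkseq (fun i => nth a0 c (f i.+2).-2) (size c).
    by apply: eq_map => i /=; rewrite add2n -fS.
  apply=> //.
  + lia.
  + by move=> i; rewrite fS fK.
  + by move=> i; rewrite gS gK.
  + by move=> i; have := f_lim i.+2; have := fS i; lia.
  + by move=> i lti; have := f_lt i.+2; have := fS i; lia.
Qed.

Definition perm_fun n (s : {perm 'I_n}) (i : nat) : nat :=
  if insub i is Some j then s j else i.

Lemma perm_funE n (s : {perm 'I_n}) (j : 'I_n) : perm_fun s j = s j.
Proof. by rewrite /perm_fun valK. Qed.

Lemma perm_fun_out n (s : {perm 'I_n}) i : n <= i -> perm_fun s i = i.
Proof. by move=> leni; rewrite /perm_fun insubF // ltnNge leni. Qed.

Lemma perm_funK n (s : {perm 'I_n}) : cancel (perm_fun s) (perm_fun s^-1%g).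
Proof.
move=> i; have [lti|leni] := ltnP i n; last by rewrite !perm_fun_out.
by rewrite -[i]/(val (Ordinal lti)) perm_funE perm_funE permK.
Qed.

Lemma permute_wordE a0 c (s : {perm 'I_(size c)}) :
  permute_word s = mkseq (fun i => nth a0 c (perm_fun s i)) (size c).
Proof.
rewrite /permute_word /mkseq -val_enum_ord -map_comp; apply: eq_map => i /=.
by rewrite perm_funE (tnth_nth a0).
Qed.

Lemma rballP c z : reflect (swapped c z) (z \in rball c).
Proof.
apply: (iffP (imfsetP _ _ _ _)) => [[s /= s_lim ->]|].
  case: c s s_lim => [|a0 c] s s_lim.
    rewrite /permute_word; have -> : enum 'I_(size ([::] : seq T)) = [::].
      by apply: size0nil; rewrite size_enum_ord.
    by constructor.
  rewrite (permute_wordE a0); apply: index_swapped (perm_funK s) _ _ _.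
  - by move=> i; rewrite -{1}(invgK s) perm_funK.
  - move=> i; have [lti|lei] := ltnP i (size (a0 :: c)).
      have := forallP s_lim (Ordinal lti).
      by rewrite -[i]/(val (Ordinal lti)) perm_funE => /andP[].
    by rewrite perm_fun_out //; split; apply: leqnSn.
  - by move=> i lti; rewrite -[i]/(val (Ordinal lti)) perm_funE ltn_ord.
case: c => [|a0 c] s.
  exists 1%g; last first.
    inversion s; apply/esym/size0nil.
    by rewrite size_map size_enum_ord.
  by apply/forallP => -[].
have [f [f_inv f_lim f_lt ->]] := swapped_index a0 s.
pose h (i : 'I_(size (a0 :: c))) := Ordinal (f_lt i (ltn_ord i)).
have h_inj : injective h.
  by move=> i j [/(can_inj f_inv) ij]; apply: val_inj.
exists (perm h_inj).
  by apply/forallP => i; rewrite permE /=; apply/andP; exact: f_lim.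
rewrite (permute_wordE a0); apply/eq_in_map => i; rewrite mem_iota => /andP[_ lti].
by rewrite -{2}[i]/(val (Ordinal lti)) perm_funE permE.
Qed.

End Swaps.

(** * Minimal distances and the boundary tests *)

Section Criterion.
Variable T : finType.
Implicit Types (a b : T) (c u v w x y z s t : seq T) (P : {fset seq T}).

Lemma bigminn_le (I : eqType) (r : seq I) n (F : I -> nat) i :
  i \in r -> \big[minn/n]_(j <- r) F j <= F i.
Proof.
elim: r => //= j r IHr; rewrite inE big_cons => /orP[/eqP ->|/IHr le_i].
  exact: geq_minl.
by rewrite (leq_trans (geq_minr _ _)).
Qed.

Lemma bigminn_attained (I : eqType) (r : seq I) n (F : I -> nat) :
  \big[minn/n]_(j <- r) F j = n \/
  exists2 i, i \in r & \big[minn/n]_(j <- r) F j = F i.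
Proof.
elim: r => [|j r IHr]; first by left; rewrite big_nil.
rewrite big_cons; have [_|_] := leqP (F j) (\big[minn/n]_(i <- r) F i).
  by right; exists j; rewrite ?mem_head.
by case: IHr => [|[i ri ?]]; [left | right; exists i; rewrite ?inE ?ri ?orbT].
Qed.

Lemma hamming_eq0 u v : size u = size v -> hamming u v = 0 -> u = v.
Proof.
elim: u v => [|a u IHu] [|b v] //= [uv].
by rewrite /hamming /=; case: eqP => //= -> /(IHu _ uv) ->.
Qed.

Lemma hamming_rcons w a b : hamming (rcons w a) (rcons w b) = (a != b).
Proof.
elim: w => [|c w IHw]; first by rewrite /hamming /= addn0.
by rewrite /hamming /= eqxx.
Qed.

Lemma Dmin_le u v u' v' :
  swapped u u' -> swapped v v' -> Dmin u v <= hamming u' v'.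
Proof.
move=> /rballP uu' /rballP vv'.
by apply: leq_trans (bigminn_le _ _ uu') (bigminn_le _ _ vv').
Qed.

Lemma Dmin_eq0 u v : size u = size v -> Dmin u v = 0 -> meet u v.
Proof.
(* For empty words the default [size u] is itself 0, but such words meet trivially. Otherwise the
   default is positive, so a minimum equal to 0 is attained by a pair. *)
case: u v => [|a u] [|b v] // uv; first by exists [::]; constructor.
pose F u' := \big[minn/size (a :: u)]_(v' <- rball (b :: v)) hamming u' v'.
rewrite /Dmin; have [-> //|[u' /rballP su' ->]] :=
  bigminn_attained (rball (a :: u)) (size (a :: u)) F.
have [|[v' /rballP sv']] :=
  bigminn_attained (rball (b :: v)) (size (a :: u)) (hamming u');
  rewrite /F => -> //.
move/hamming_eq0 => E; exists u' => //; rewrite E //.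
by rewrite (size_swapped su') (size_swapped sv').
Qed.

Lemma meet_sym c c' : meet c c' -> meet c' c.
Proof. by case=> z; exists z. Qed.

(** Both prefixes inherit all but the last letter of the common word by [swapped_prefix], hence
    share [w]. *)
Lemma meet_prefix u v s t : u != [::] -> size u = size v ->
  meet (u ++ s) (v ++ t) -> exists w b b',
  [/\ (size w).+1 = size u, swapped u (rcons w b) & swapped v (rcons w b')].
Proof.
case/lastP: u => // u a _; case/lastP: v => [|v a']; rewrite !size_rcons //.
move=> [uv] [z /swapped_prefix[b sb] /swapped_prefix[b' sb']].
exists (take (size u) z), b, b'; split=> //; last by rewrite uv.
by have := size_swapped sb; rewrite !size_rcons.
Qed.

(** The pair given by [meet_prefix] contradicts (E1) if its last letters agree and (E2) if they
    differ. *)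
Lemma same_length_test_meet u v s t : u != [::] -> size u = size v ->
  same_length_test u v -> ~ meet (u ++ s) (v ++ t).
Proof.
move=> u0 uv [D0 D1] /(meet_prefix u0 uv)[w [b [b' [sw su sv]]]].
have := Dmin_le su sv; rewrite hamming_rcons.
have [_|bb' D_le] := eqVneq b b'; first by rewrite leqn0 => /eqP.
have {}D1 := D1 _; apply: D1; first by move: D0 D_le => /=; lia.
exists (rcons w b), (rcons w b'); split.
  by split; [exact/rballP | exact/rballP | rewrite hamming_rcons bb'].
rewrite -sw !onthE !map_rcons !nth_rcons size_map ltnn eqxx.
by case=> /eqP; apply/negP.
Qed.

(** * Concatenations of certified blocks have disjoint balls *)

Section Certified.
Variable P : {fset seq T}.
Hypotheses (P_nil : [::] \notin P) (P_cert : certified P).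
Implicit Types ps qs : seq (seq T).

Lemma mem_block_neq_nil x : x \in P -> x != [::].
Proof. by apply: contraTneq => ->. Qed.

Lemma certified_meet_le x y ps qs : x \in P -> y \in P -> {subset ps <= P} ->
  x <> y -> size x <= size y ->
  size (flatten (x :: ps)) = size (flatten (y :: qs)) ->
  ~ meet (flatten (x :: ps)) (flatten (y :: qs)).
Proof.
move=> xP yP psP xy; have [same two] := P_cert; rewrite leq_eqVlt.
case/orP=> [/eqP eq_xy _|lt_xy] /=.
  by apply: same_length_test_meet (same _ _ xP yP xy eq_xy);
    rewrite ?mem_block_neq_nil.
rewrite !size_cat => sz m; have [D0 D1] := two _ _ xP yP lt_xy.
have size_y0 : size x = size (take (size x) y) by rewrite size_takel // ltnW.
set d := size y - size x in D1.
have le_d : d <= size (flatten ps) by rewrite /d; lia.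
(* The [d] letters that follow [x] serve as the prefix in (U2); equal total lengths guarantee that
   there are enough of them. Cutting the common word after [size x] letters bounds the distance by
   1, and (U1) excludes 0, so (U2) applies. *)
have test : same_length_test (x ++ take d (flatten ps)) y.
  apply: D1; last by exists (flatten ps); split=> //; exists ps.
  move: (m) D0; rewrite -{1}[y](cat_take_drop (size x)) -catA.
  case/(meet_prefix (mem_block_neq_nil xP) size_y0)=> w [b [b' [_ sx sy]]].
  have := Dmin_le sx sy; rewrite hamming_rcons.
  by case: (b != b') => /=; case: (Dmin _ _) => [|[]].
apply: (@same_length_test_meet _ _ (drop d (flatten ps)) (flatten qs) _ _ test).
- by case: (x) (mem_block_neq_nil xP).
- by rewrite size_cat size_takel // /d subnKC // ltnW.
- by rewrite -catA cat_take_drop.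
Qed.

(** Induction on the factorisations: a common first block cancels by [meet_catl], and distinct first
    blocks are ruled out by [certified_meet_le], with the shorter one placed first. *)
Lemma certified_meet ps qs : {subset ps <= P} -> {subset qs <= P} ->
  size (flatten ps) = size (flatten qs) ->
  meet (flatten ps) (flatten qs) -> ps = qs.
Proof.
have size_gt0 x : x \in P -> 0 < size x.
  by move=> /mem_block_neq_nil; rewrite lt0n size_eq0.
elim: ps qs => [|x ps IHps] [|y qs] //.
- by move=> _ /(_ y (mem_head _ _)) /size_gt0; rewrite /= size_cat; lia.
- by move=> /(_ x (mem_head _ _)) /size_gt0; rewrite /= size_cat; lia.
move=> xpsP yqsP sz.
have [xP yP] : x \in P /\ y \in P by rewrite xpsP ?yqsP ?mem_head.
have psP : {subset ps <= P} by move=> w wps; rewrite xpsP // inE wps orbT.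
have qsP : {subset qs <= P} by move=> w wqs; rewrite yqsP // inE wqs orbT.
have [xy|/eqP xy m] := eqVneq x y.
  move: sz; rewrite xy /= !size_cat => /addnI sz /meet_catl m.
  by rewrite (IHps qs).
have [le_xy|/ltnW le_yx] := leqP (size x) (size y).
  by case: (certified_meet_le xP yP psP xy le_xy sz m).
by case: (certified_meet_le yP xP qsP (nesym xy) le_yx (esym sz) (meet_sym m)).
Qed.

End Certified.

(** * Correcting codes and their padding to certified block sets *)

Lemma correctingP n (C : {set n.-tuple T}) :
  reflect (C != finset.set0 /\
           {in C &, forall c c' : n.-tuple T, meet c c' -> c = c'})
          (correcting C).
Proof.
apply: (iffP andP) => -[C0 CP]; split=> // .
  move=> c c' cC c'C [z /rballP cz /rballP c'z]; apply/eqP/contraT => neq.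
  move/forall_inP: CP => /(_ c cC)/forall_inP/(_ c' c'C)/implyP/(_ neq).
  by move/fdisjointP/(_ z cz); rewrite c'z.
apply/forall_inP => c cC; apply/forall_inP => c' c'C; apply/implyP => neq.
apply/fdisjointP => z /rballP cz; apply/negP => /rballP c'z.
by case/eqP: neq; apply: CP => //; exists z.
Qed.

(** The last letter either stays or is exchanged with its neighbour, which is also [a]. *)
Lemma swapped_padded_last w a z :
  swapped (w ++ [:: a; a]) z ->
  onth z (size (w ++ [:: a; a])).-1 = Some a.
Proof.
move=> s; have := size_swapped s; rewrite size_cat addn2.
have [z' /(canRL revK) ->] : exists z', rev z = a :: z'.
  move/swapped_rev: s; rewrite rev_cat.
  by case/swapped_consE=> [[z' -> _]|[_ [_ [z' [[<- _] -> _]]]]];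
    [exists z' | exists (a :: z')].
rewrite rev_cons size_rcons => -[sz].
by rewrite onthE map_rcons nth_rcons size_map sz ltnn eqxx.
Qed.

(* After the padding, position [n.+2] always carries [a], so no closest witness
   differs there. *)
Definition padded_code n (C : {set n.-tuple T}) a : {fset seq T} :=
  [fset (tval c ++ [:: a; a]) | c in C]%fset.

(** If the minimal distance is 0, the padding can be stripped by [meet_rcons] and [C] is not
    correcting; this gives (E1). (E2) is [swapped_padded_last], and (C2) is vacuous because all
    blocks have the same length. *)
Lemma padded_code_certified n (C : {set n.-tuple T}) a :
  correcting C -> block_set (padded_code C a) /\ certified (padded_code C a).
Proof.
case/correctingP=> C0 CP; split; [split|split].
- have /set0Pn[c cC] := C0; apply/fset0Pn.
  by exists (tval c ++ [:: a; a]); apply/imfsetP; exists c.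
- by apply/imfsetP => -[[[|? ?] ?]].
- move=> _ _ /imfsetP[c /= cC ->] /imfsetP[c' /= c'C ->] neq sz; split.
    move=> /(Dmin_eq0 sz); rewrite -!cat_rcons !cats0.
    move=> /meet_rcons/meet_rcons /(CP _ _ cC c'C) E.
    by case: neq; rewrite E.
  move=> _ [u [v [[/rballP su /rballP sv _]]]].
  by rewrite (swapped_padded_last su) sz (swapped_padded_last sv).
- by move=> _ _ /imfsetP[c /= cC ->] /imfsetP[c' /= c'C ->];
    rewrite !size_cat !size_tuple ltnn.
Qed.

End Criterion.

Local Open Scope ring_scope.

(** * Block rates as roots of the growth equation *)

Section Rates.
Variables (R : realType) (q : nat).
Hypothesis q_ge2 : (2 <= q)%N.
Implicit Types (P : {fset seq 'I_q}) (lam : R).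

Lemma ln_q_gt0 : 0 < ln q%:R :> R.
Proof. by rewrite ln_gt0 // ltr1n. Qed.

Lemma ln_nat_ge0 n : 0 <= ln n%:R :> R.
Proof. by case: n => [|n]; [rewrite ln0 | rewrite ln_ge0 // ler1n]. Qed.

Lemma max_code_size_attained n :
  {C : {set n.-tuple 'I_q} | correcting C & max_code_size 'I_q n = #|C|}.
Proof.
apply: eq_bigmax_cond; pose c := [tuple of nseq n (Ordinal (ltnW q_ge2))].
apply/card_gt0P; exists (finset.set1 c); apply/correctingP; split.
  by apply/set0Pn; exists c; rewrite finset.in_set1.
by move=> x y /finset.set1P -> /finset.set1P ->.
Qed.

Lemma max_code_size_le n : (max_code_size 'I_q n <= q ^ n)%N.
Proof.
by have [C _ ->] := max_code_size_attained n;
  rewrite (leq_trans (max_card _)) // card_tuple card_ord.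
Qed.

(** The sum over lengths starts at 1, so every block is counted precisely because none is empty. *)
Lemma growth_sumE P lam : [::] \notin P ->
  \sum_(1 <= l < (\max_(p <- P) size p).+1) (block_count P l)%:R * lam ^- l =
  \sum_(p <- P) lam ^- size p.
Proof.
move=> P_nil; have countE l : (block_count P l)%:R * lam ^- l =
    \sum_(p <- P | size p == l) lam ^- size p.
  rewrite (eq_bigr (fun=> lam ^- l)) => [|p /eqP-> //].
  by rewrite big_fset_condE big_const_seq count_predT iter_addr_0 mulr_natl.
rewrite (eq_bigr _ (fun l _ => countE l)).
rewrite (exchange_big_dep xpredT) //= big_seq [RHS]big_seq.
apply: eq_bigr => p pP.
have size_p : (0 < size p < (\max_(p <- P) size p).+1)%N.
  rewrite lt0n size_eq0 (contraTneq _ pP) => [|-> //]; rewrite ltnS /=.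
  by apply: leq_bigmax_seq.
rewrite (big_rem (size p)) ?mem_index_iota //= eqxx big1_seq ?addr0 //.
move=> i /andP[/eqP <-].
by rewrite mem_rem_uniq ?iota_uniq // inE eqxx.
Qed.

Lemma padded_code_rate n (C : {set n.-tuple 'I_q}) a : correcting C ->
  block_rate R (padded_code C a) = logq q #|C|%:R / n.+2%:R.
Proof.
move=> C_corr; have [[_ P_nil] _] := padded_code_certified a C_corr.
have rootE lam : growth_root (padded_code C a) lam <->
    0 < lam /\ lam ^+ n.+2 = #|C|%:R.
  rewrite /growth_root growth_sumE // big_imfset /=; last first.
    by move=> c c' _ _ /eqP; rewrite eqseq_cat ?size_tuple // => /andP[/eqP/val_inj].
  rewrite (eq_bigr (fun=> lam ^- n.+2)) => [|c _]; last first.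
    by rewrite size_cat size_tuple addn2.
  rewrite big_enum /= sumr_const -[_ *+ _]mulr_natl.
  split=> -[lam_gt0 E]; split=> //;
    have lam_neq0 := lt0r_neq0 (exprn_gt0 n.+2 lam_gt0).
    by rewrite -[RHS](mulfVK lam_neq0) E mul1r.
  by rewrite -E mulfV.
have C_gt0 : 0 < #|C|%:R :> R.
  by rewrite ltr0n card_gt0; case/correctingP: C_corr.
(* An explicit root keeps [xget] from returning its default; the rate then follows from the equation
   alone. *)
have /(xgetPex 1)/rootE[lam_gt0 lamE] :
    exists lam, growth_root (padded_code C a) lam.
  exists (expR (ln #|C|%:R / n.+2%:R)); apply/rootE; rewrite expR_gt0; split=> //.
  by rewrite -expRM_natl mulrC divfK ?lnK ?posrE // pnatr_eq0.
rewrite /block_rate /logq -lamE lnXn // -[ln _ *+ _]mulr_natr mulrAC mulfK //.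
Qed.

(** * Large correcting codes from concatenated certified blocks *)

Section Certified.
Variable P : {fset seq 'I_q}.
Hypotheses (P_nil : [::] \notin P) (P_cert : certified P).

(** Choices of [m] blocks are finite functions, the form over which a product of [m] sums
    expands. *)
Definition block_word m (f : {ffun 'I_m -> P}) : seq 'I_q :=
  flatten [seq val (f i) | i <- enum 'I_m].

Lemma size_block_word m (f : {ffun 'I_m -> P}) :
  size (block_word f) = (\sum_(i < m) size (val (f i)))%N.
Proof. by rewrite size_flatten /shape -map_comp sumnE big_map big_enum. Qed.

Lemma block_word_meet m (f g : {ffun 'I_m -> P}) :
  size (block_word f) = size (block_word g) ->
  meet (block_word f) (block_word g) -> f = g.
Proof.
have sub (h : {ffun 'I_m -> P}) : {subset [seq val (h i) | i <- enum 'I_m] <= P}.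
  by move=> _ /mapP[i _ ->]; apply: fsvalP.
move=> sz /(certified_meet P_nil P_cert (sub f) (sub g) sz)/eq_in_map fg.
by apply/ffunP => i; apply: val_inj; apply: fg; rewrite mem_enum.
Qed.

(** The words of length [k] made of [m] blocks form a correcting code by [block_word_meet]. Every
    word meets itself, so the same fact shows that distinct choices give distinct words. *)
Lemma card_block_word m k :
  (#|[set f : {ffun 'I_m -> P} | size (block_word f) == k]| <=
   max_code_size 'I_q k)%N.
Proof.
set F := finset _; have [->|[f0 f0F]] := set_0Vmem F; first by rewrite cards0.
have size_F f : f \in F -> size (block_word f) == k by rewrite finset.inE.
pose code (f : {ffun 'I_m -> P}) : k.-tuple 'I_q :=
  insubd (Tuple (size_F _ f0F)) (block_word f).
have codeE f : f \in F -> code f = block_word f :> seq _.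
  by move=> fF; rewrite val_insubd size_F.
have code_meet : {in F &, forall f g, meet (code f) (code g) -> f = g}.
  move=> f g fF gF; rewrite !codeE //; apply: block_word_meet.
  by rewrite (eqP (size_F _ fF)) (eqP (size_F _ gF)).
have code_inj : {in F &, injective code}.
  move=> f g fF gF fg; apply: code_meet => //; rewrite fg.
  by exists (code g); apply: swapped_refl.
rewrite -(card_in_imset code_inj).
suff F_corr : correcting [set code f | f in F].
  exact: (@leq_bigmax_cond _ _ (fun C : {set k.-tuple 'I_q} => #|C|) _ F_corr).
apply/correctingP; split; first by apply/set0Pn; exists (code f0); apply: imset_f.
by move=> _ _ /imsetP[f fF ->] /imsetP[g gF ->] /code_meet ->.
Qed.

(* Weighting words by [lam ^- size] makes the blocks, hence the [m]-tuples of
   blocks, have total weight 1; some length carries at least the average. *)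
Lemma max_code_size_lower lam m : 0 < lam ->
  \sum_(p <- P) lam ^- size p = 1 -> let L := (\max_(p <- P) size p)%N in
  exists2 k, (m <= k)%N &
    lam ^+ k <= (m * L).+1%:R * (max_code_size 'I_q k)%:R.
Proof.
move=> lam_gt0 sum1 L.
pose N k := #|[set f : {ffun 'I_m -> P} | size (block_word f) == k]|.
have size_gt0 (p : P) : (0 < size (val p))%N.
  by rewrite lt0n size_eq0 (contraNneq _ P_nil) // => <-; apply: fsvalP.
have size_leL (p : P) : (size (val p) <= L)%N.
  by apply: leq_bigmax_seq (fsvalP p) _.
have size_le f : (size (@block_word m f) <= m * L)%N.
  rewrite size_block_word -[X in (X * _)%N](card_ord m) -sum_nat_const.
  exact: leq_sum.
have size_ge f : (m <= size (@block_word m f))%N.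
  rewrite size_block_word -[X in (X <= _)%N](card_ord m) -sum1_card.
  exact: leq_sum.
have weight1 : \sum_(k < (m * L).+1) (N k)%:R * lam ^- k = 1.
  transitivity (\sum_(f : {ffun 'I_m -> P}) lam ^- size (block_word f)).
    rewrite (partition_big
      (fun f => inord (size (block_word f)) : 'I_(m * L).+1) xpredT) //=.
    apply: eq_bigr => k _.
    rewrite (eq_bigl (mem [set f | size (@block_word m f) == k])).
      rewrite (eq_bigr (fun=> lam ^- k)) => [|f]; last first.
        by rewrite !finset.inE => /eqP->.
      by rewrite sumr_const mulr_natl.
    by move=> f /=; rewrite finset.inE -val_eqE /= inordK ?ltnS.
  (* The weight is multiplicative under concatenation, so the total is the [m]-th power of the
     weight of [P]. *)
  transitivity (\prod_(i < m) \sum_(p : P) lam ^- size (val p)).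
    rewrite bigA_distr_bigA; apply: eq_bigr => f _.
    by rewrite size_block_word expr_sum prodfV.
  by apply: big1 => i _; rewrite -[RHS]sum1 [RHS]big_seq_fsetE.
have [k Nk] : exists k : 'I_(m * L).+1, (m * L).+1%:R^-1 <= (N k)%:R * lam ^- k.
  apply/existsP; apply: contraT; rewrite negb_exists => /forallP lt_N.
  have : \sum_(k < (m * L).+1) (N k)%:R * lam ^- k < 1.
    have sumE : 1 = \sum_(k < (m * L).+1) (m * L).+1%:R^-1 :> R.
      by rewrite sumr_const card_ord -[RHS]mulr_natr mulVf // pnatr_eq0.
    rewrite [ltRHS]sumE; apply: ltr_sum => [|k _]; last first.
      by rewrite ltNge; apply: lt_N.
    by apply/hasP; exists ord0; rewrite ?mem_index_enum.
  by rewrite weight1 ltxx.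
exists k.
  (* The chosen length is realised by some word of [m] nonempty blocks, hence is at least [m]; this
     lets [k] be forced arbitrarily large. *)
  have : (0 < N k)%N.
    rewrite lt0n; apply: contraTneq Nk => ->.
    by rewrite mul0r -ltNge invr_gt0 ltr0n.
  by case/card_gt0P => f; rewrite finset.inE => /eqP <-.
have: lam ^+ k <= (m * L).+1%:R * (N k)%:R.
  by move: Nk; rewrite ler_pdivlMr ?exprn_gt0 // ler_pdivrMl ?ltr0n // mulrC.
by move/le_trans; apply; rewrite ler_pM2l ?ltr0n // ler_nat card_block_word.
Qed.

End Certified.

(** * The two inequalities between capacity and certified rates *)

Lemma ln_affine_le (d : R) (L k : nat) : 0 < d -> (4 * L)%:R / d ^+ 2 <= k%:R ->
  ln (k * L).+1%:R <= k%:R * d.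
Proof.
move=> d_gt0; rewrite ler_pdivrMr ?exprn_gt0 // natrM => le_k.
rewrite -ler_expR lnK ?posrE ?ltr0n //.
(* Halving the exponent gives a quadratic lower bound: exp(kd) is at least (1 + kd/2)^2, whose term
   k^2 d^2 / 4 dominates kL once k is at least 4L / d^2. *)
have -> : k%:R * d = 2%:R * (k%:R * d / 2) by rewrite [RHS]mulrC divfK ?pnatr_eq0.
rewrite expRM_natl; apply: le_trans (_ : (1 + k%:R * d / 2) ^+ 2 <= _); last first.
  rewrite lerXn2r ?nnegrE ?expR_ge0 ?expR_ge1Dx //.
  by rewrite addr_ge0 // divr_ge0 // mulr_ge0 // ltW.
rewrite -natr1 natrM.
have k_ge0 : 0 <= k%:R :> R := ler0n _ _.
have := ler_wpM2l k_ge0 le_k.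
have := mulr_ge0 k_ge0 (ltW d_gt0).
nra.
Qed.

Lemma block_rate_le_capacity P : block_set P -> certified P ->
  ((block_rate R P)%:E <= capacity R q)%E.
Proof.
pose u k := (logq q (max_code_size 'I_q k)%:R / k%:R)%:E : \bar R.
(* The limit superior is an infimum over neighbourhoods [V] of infinity of suprema over [V]; it
   suffices to find a large enough term in each tail. *)
case=> _ P_nil P_cert; apply: le_ereal_inf_tmp => _ [V [N _ VN] <-].
have sup_ge k : (N <= k)%N -> (u k <= ereal_sup (u @` V))%E.
  by move=> leNk; apply: ereal_sup_ubound; exists k => //; apply: VN.
rewrite /block_rate; case: xgetP => [lam _ [lam_gt0]|_]; last first.
  (* Without a root the default 1 gives rate 0, which is below every term of the sequence. *)
  have -> : logq q 1 = 0 :> R by rewrite /logq ln1 mul0r.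
  apply: (le_trans _ (sup_ge N (leqnn N))).
  by rewrite lee_fin !divr_ge0 ?ln_nat_ge0 // ltW // ln_q_gt0.
rewrite growth_sumE // => sum1; apply/lee_addgt0Pr => e e_gt0.
set L := (\max_(p <- P) size p)%N.
(* [d] is the error [e] expressed in natural logarithms. The choice of [m] makes [k] at least [N],
   positive, and large enough for [ln_affine_le]. *)
pose d := e * ln q%:R; have d_gt0 : 0 < d by rewrite mulr_gt0 ?ln_q_gt0.
pose m := maxn N (Num.bound ((4 * L)%:R / d ^+ 2)).+1.
have [k le_mk lam_k] := max_code_size_lower P_nil P_cert m lam_gt0 sum1.
have k_gt0 : 0 < k%:R :> R.
  by rewrite ltr0n (leq_trans _ le_mk) // /m leq_max orbT.
have ge_k : (4 * L)%:R / d ^+ 2 <= k%:R.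
  apply: le_trans (ltW (archi_boundP _)) _.
    by rewrite divr_ge0 // exprn_ge0 // ltW.
  by rewrite ler_nat (leq_trans _ le_mk) // /m leq_max leqnSn orbT.
apply: le_trans (leeD2r _ (sup_ge k _)); last first.
  by rewrite (leq_trans _ le_mk) // leq_maxl.
rewrite -EFinD lee_fin /logq.
set A := (max_code_size _ k)%:R in lam_k *.
have A_gt0 : 0 < A.
  by rewrite -(pmulr_rgt0 _ (ltr0Sn R (m * L))) (lt_le_trans _ lam_k) ?exprn_gt0.
(* Since [m] is at most [k], the factor mL + 1 is at most kL + 1, whose logarithm is absorbed by the
   error kd. *)
have ln_le : ln lam * k%:R <= k%:R * d + ln A.
  rewrite mulr_natr -lnXn //; apply: le_trans (_ : ln ((k * L).+1%:R * A) <= _).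
    rewrite ler_ln ?posrE ?mulr_gt0 ?exprn_gt0 ?ltr0Sn //.
    apply: le_trans lam_k _; rewrite ler_pM2r // ler_nat ltnS.
    by rewrite leq_mul2r le_mk orbT.
  by rewrite lnM ?posrE ?ltr0Sn // lerD2r ln_affine_le.
rewrite -[e](mulfK (lt0r_neq0 ln_q_gt0)) -/d.
rewrite mulrAC -mulrDl ler_pM2r ?invr_gt0 ?ln_q_gt0 //.
by rewrite -lerBlDr ler_pdivlMr // mulrBl lerBlDl [d * _]mulrC.
Qed.

Lemma logq_max_code_size_le n : logq q (max_code_size 'I_q n)%:R <= n%:R :> R.
Proof.
have [C C_corr CE] := max_code_size_attained n.
have C_gt0 : (0 < max_code_size 'I_q n)%N.
  by rewrite CE card_gt0; case/correctingP: C_corr.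
rewrite ler_pdivrMr ?ln_q_gt0 // mulr_natl -lnXn ?ltr0n ?(ltnW q_ge2) //.
rewrite -natrX ler_ln ?posrE ?ltr0n ?expn_gt0 ?(ltnW q_ge2) //.
by rewrite ler_nat max_code_size_le.
Qed.

(** With x the logarithm of the code size, two padding letters lower the rate by x/n - x/(n+2) =
    2x/(n(n+2)). As x is at most n, this is below [e] as soon as n is at least 2/e, which is how [N]
    is chosen. *)
Lemma capacity_le_rho_crit : (capacity R q <= rho_crit R q)%E.
Proof.
have rho_ge n : ((logq q (max_code_size 'I_q n)%:R / n.+2%:R : R)%:E <=
    rho_crit R q)%E.
  have [C C_corr ->] := max_code_size_attained n.
  have a : 'I_q := Ordinal (ltnW q_ge2).
  apply: ereal_sup_ubound; exists (padded_code C a).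
    exact: padded_code_certified.
  by rewrite padded_code_rate.
apply/lee_addgt0Pr => e e_gt0.
pose N := (Num.bound (2 / e)).+1.
pose u k := (logq q (max_code_size 'I_q k)%:R / k%:R)%:E : \bar R.
apply: ge_ereal_inf; exists (ereal_sup (u @` [set k | (N <= k)%N]%classic)).
  by exists [set k | (N <= k)%N]%classic => //; exists N.
apply: ge_ereal_sup => _ [n /= leNn <-].
apply: le_trans (leeD2r _ (rho_ge n)).
rewrite -EFinD lee_fin; set x := logq _ _.
have x_le : x <= n%:R := logq_max_code_size_le n.
have n_ge : 2 / e <= n%:R.
  apply: le_trans (ltW (archi_boundP _)) _; first by rewrite divr_ge0 // ltW.
  by rewrite ler_nat ltnW.
have n_gt0 : 0 < n%:R :> R by rewrite ltr0n (leq_trans _ leNn).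
rewrite ler_pdivrMr // in n_ge.
have -> : n.+2%:R = n%:R + 2 :> R by rewrite -addn2 natrD.
rewrite ler_pdivrMr // mulrDl mulrAC.
rewrite -lerBlDl
  -[X in X - _](mulfK (lt0r_neq0 (_ : 0 < n%:R + 2 :> R))); last first.
  by rewrite addr_gt0.
rewrite -mulrBl mulrDr addrAC subrr add0r ler_pdivrMr ?addr_gt0 //.
nra.
Qed.

End Rates.

Theorem theorem7 (R : realType) :
  (forall q : nat, (2 <= q)%N -> rho_crit R q = capacity R q) /\
  rho_crit R 2 = capacity R 2.
Proof.
have main q : (2 <= q)%N -> rho_crit R q = capacity R q.
  move=> q_ge2; apply/eqP; rewrite eq_le capacity_le_rho_crit // andbT.
  apply: ge_ereal_sup => _ [P [P_block P_cert] <-].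
  exact: block_rate_le_capacity.
by split; [exact: main | exact: main].
Qed.
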